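(* Let $f(x)=x^n+a_{n-1}x^{n-1}+\dots+a_1x+a_0\in\mathbb{Z}[x]$ be a monic irreducible polynomial of prime degree $n$ with roots $\alpha_1,\dots,\alpha_n$, splitting field $K\subset\mathbb{C}$, and $d=[K:\mathbb{Q}]$. Let $L_f=\operatorname{span}_{\mathbb{Z}}\{\Sigma_K(\alpha_1),\dots,\Sigma_K(\alpha_n)\}$. Then: (1) $L_f$ has rank $n$ if $a_{n-1}\neq 0$ and rank $n-1$ if $a_{n-1}=0$. (2) If $|L_f|<\sqrt{d}\,|a_{n-1}|$, then the cardinality of $S(L_f)$ is divisible by $n$.
   Context: The Galois group $G=\operatorname{Gal}(K/\mathbb{Q})=\{\sigma_1,\dots,\sigma_d\}$ is identified with the set of embeddings $K\hookrightarrow\mathbb{C}$, and $\Sigma_K=(\sigma_1,\dots,\sigma_d):K\to\mathbb{C}^d$ is the Minkowski embedding. $\mathbb{C}^d$ carries the inner product $\langle\boldsymbol x,\boldsymbol y\rangle=\sum_k x_k\overline{y_k}$ and norm $\|\boldsymbol x\|=\sqrt{\langle \boldsymbol x,\boldsymbol x\rangle}$. For a lattice $L$, $|L|=\min\{\|\boldsymbol x\|:\boldsymbol x\in L\setminus\{\boldsymbol 0\}\}$ is its minimal norm and $S(L)=\{\boldsymbol x\in L:\|\boldsymbol x\|=|L|\}$ its set of minimal vectors. *)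

(* Defs.v *)
From mathcomp Require Import all_boot all_order all_algebra all_fingroup all_field.
From mathcomp Require Import complex.
From mathcomp Require Import boolp classical_sets functions cardinality reals.

Set Implicit Arguments.
Unset Strict Implicit.
Unset Printing Implicit Defensive.

Import Order.TTheory GRing.Theory Num.Theory.

Local Open Scope ring_scope.
Local Open Scope complex_scope.
Local Open Scope classical_set_scope.

Section Minkowski.
Variables (R : realType) (K : splittingFieldType rat).

(* The inclusion of K in the complex numbers is the ring morphism iota; the
   embeddings of K are then the maps iota \o s, for s in the Galois group. *)
Definition minkowski (iota : {rmorphism K -> R[i]}) (d : nat)
    (sigma : d.-tuple (gal_of {:K})) (x : K) : 'rV[R[i]]_d :=
  \row_k iota (tnth sigma k x).

End Minkowski.

Section Lattices.
Variables (R : realType) (d : nat).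
Implicit Types (x y : 'rV[R[i]]_d) (L : set 'rV[R[i]]_d).

Definition inner x y : R[i] := \sum_k x ord0 k * (y ord0 k)^*.

(* inner x x is real, so that taking its real part loses nothing. *)
Definition enorm x : R := Num.sqrt (complex.Re (inner x x)).

Definition zspan (m : nat) (b : 'I_m -> 'rV[R[i]]_d) : set 'rV[R[i]]_d :=
  [set x | exists c : 'I_m -> int, x = \sum_i b i *~ c i].

Definition real_free (m : nat) (b : 'I_m -> 'rV[R[i]]_d) : Prop :=
  forall c : 'I_m -> R, \sum_i (c i)%:C *: b i = 0 -> forall i, c i = 0.

(* L is a lattice of rank r in the underlying real vector space of C^d. *)
Definition lattice_rank L (r : nat) : Prop :=
  exists b : 'I_r -> 'rV[R[i]]_d, real_free b /\ L = zspan b.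

Definition is_min_norm L (m : R) : Prop :=
  (exists x, [/\ L x, x != 0 & enorm x = m]) /\
  (forall x, L x -> x != 0 -> m <= enorm x).

(* The minimum is unique when it exists; the default value 0 is not the norm of
   a nonzero vector. *)
Definition min_norm L : R := xget 0 [set m | is_min_norm L m].

Definition min_vectors L : set 'rV[R[i]]_d :=
  [set x | L x /\ enorm x = min_norm L].

Lemma min_norm_eq L m : is_min_norm L m -> min_norm L = m.
Proof.
move=> Lm; apply: xget_unique => // m' [[x' [Lx' x'0 <-]] min'].
have [[x [Lx x0 xm]] minm] := Lm.
by apply/le_anti; rewrite minm // andbT -xm min'.
Qed.

End Lattices.

(* Main.v *)
(* The degree of f divides the order of the Galois group, so by Cauchy the group
   has an element g of prime order n.  It moves some root x, and its orbit then
   consists of n distinct roots, hence of all of them: the roots are the g^i x,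
   0 <= i < n.  As 1 + X + ... + X^(n-1) is irreducible over Q, a rational linear
   relation among the g^i x has all its coefficients equal, i.e. it is a multiple
   of the trace.  By Dedekind's independence of characters, the Minkowski
   embedding turns linear independence over Q into linear independence over C.

   For the minimal vectors, g acts isometrically on L_f with g^n = 1, so it
   suffices that g fixes no minimal vector.  If a_(n-1) <> 0, a fixed vector of
   L_f is an integer multiple of the image of the trace, an image whose
   norm is sqrt d * |a_(n-1)|. *)
Require Import Defs.
From mathcomp Require Import all_boot all_order all_algebra all_fingroup all_field.
From mathcomp Require Import all_solvable.
From mathcomp Require Import finmap.
From mathcomp Require Import complex.
From mathcomp Require Import boolp classical_sets functions cardinality reals.

Set Implicit Arguments.
Unset Strict Implicit.
Unset Printing Implicit Defensive.

Import Order.TTheory GRing.Theory Num.Theory.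

Local Open Scope ring_scope.
Local Open Scope complex_scope.
Local Open Scope classical_set_scope.
Local Open Scope card_scope.

(** * Rational relations in a cyclic orbit of prime length *)

(** The minimal polynomial [p] of a primitive [n]-th root of unity [z] divides the sum, and both
    have size [n] as the totient of a prime [n] is n - 1. *)
Lemma irreducible_geometric_sum (n : nat) :
  prime n -> irreducible_poly (\sum_(i < n) 'X^i : {poly rat}).
Proof.
move=> n_pr; have n_gt0 := prime_gt0 n_pr.
set P := \sum_(i < n) _.
have szP : size P = n.
  have -> : P = \poly_(i < n) 1.
    by rewrite poly_def; apply: eq_bigr => i _; rewrite scale1r.
  by rewrite size_poly_eq ?oner_neq0.
have [z z_prim] := C_prim_root_exists n_gt0.
have [p [Dp p_mon] root_p] := minCpolyP z.
have szp : size p = n.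
  rewrite -(size_map_poly (@ratr algC)) -Dp (minCpoly_cyclotomic z_prim).
  by rewrite size_cyclotomic totient_prime // prednK.
have pP : p %| P.
  rewrite -root_p /root rmorph_sum /= horner_sum.
  rewrite (eq_bigr (fun i : 'I_n => z ^+ i)); last first.
    by move=> i _; rewrite rmorphXn /= map_polyX hornerXn.
  have /eqP := subrX1 z n; rewrite (prim_expr_order z_prim) subrr eq_sym mulf_eq0.
  rewrite subr_eq0 => /orP[/eqP z1|//].
  by have := prim_order_dvd z_prim 1; rewrite expr1 z1 eqxx dvdn1 => /eqP n1; rewrite n1 in n_pr.
have P0 : P != 0 by rewrite -size_poly_gt0 szP.
have eqpP : p %= P by rewrite -dvdp_size_eqp // szp szP.
split; first by rewrite szP prime_gt1.
move=> q q1 qP; have q0 : q != 0 by apply: contraNneq P0 => q0; rewrite q0 dvd0p in qP.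
have rP : root (map_poly ratr P) z by rewrite root_p.
(* Since [z] is a root of [q] or of [P %/ q], one of them is a multiple of [p]; in the second case
   the sizes force [q] to be a nonzero constant, against [q1]. *)
have [|] := boolP (p %| q).
  by rewrite (eqp_dvdl _ eqpP) => Pq; rewrite /eqp qP Pq.
rewrite -root_p => nr; exfalso.
have e := divpK qP.
move: rP; rewrite -e rmorphM rootM (negPf nr) orbF root_p => pPq.
have Pq0 : P %/ q != 0 by apply: contraNneq P0 => h; rewrite -e h mul0r.
have := dvdp_leq Pq0 pPq; rewrite size_divp // szp szP.
have : (size q <= n)%N by rewrite -szP dvdp_leq.
have : (0 < size q)%N by rewrite size_poly_gt0.
move: q1; case: (size q) => [|[|k]] //= _ _ kn; rewrite leqNgt => /negP[].
by rewrite ltn_subrL n_gt0 andbT.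
Qed.

Section Cyclic.
Import FalgLfun.

(* If c were not constant, the polynomial with coefficients c would be coprime
   to P = 1 + X + ... + X^(n-1), hence invertible modulo P.  It kills x at X = g,
   so x = v(g) (P(g) x) for some v, and x would be fixed by g as P(g) x is. *)
Lemma cyclic_relation_const (n : nat) (K : fieldExtType rat) (g : 'End(K)) (x : K)
    (c : 'I_n -> rat) :
  prime n -> iter n g x = x -> g x != x ->
  \sum_(i < n) c i *: iter i g x = 0 -> forall i j, c i = c j.
Proof.
move=> n_pr gnx gx cx0.
have n_gt0 := prime_gt0 n_pr.
have Dx (p : {poly rat}) (m : nat) : (size p <= m)%N ->
    horner_alg g p x = \sum_(i < m) p`_i *: iter i g x.
  move=> szp; have -> : horner_alg g p = \sum_(i < m) p`_i *: g ^+ i.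
    rewrite -[p in LHS]coefK poly_def (big_ord_widen _ (fun i => p`_i *: 'X^i) szp).
    rewrite linear_sum big_mkcond; apply: eq_bigr => i _.
    case: ltnP => h; last by rewrite nth_default ?scale0r //.
    by rewrite linearZ rmorphXn /= horner_algX mulr_algl.
  rewrite sum_lfunE; apply: eq_bigr => i _; rewrite scale_lfunE; congr (_ *: _).
  elim: (val i) => [|k IHk] /=; first by rewrite expr0 id_lfunE.
  by rewrite exprSr lfun_mulE IHk.
set p := \poly_(i < n) (if insub i is Some j then c j else 0).
have pE (i : 'I_n) : p`_i = c i by rewrite coef_poly ltn_ord valK.
have px : horner_alg g p x = 0.
  rewrite (Dx p n) ?size_poly //.
  by rewrite -[RHS]cx0; apply: eq_bigr => i _; rewrite pE.
set P : {poly rat} := \sum_(i < n) 'X^i.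
have PE : P = \poly_(i < n) 1.
  by rewrite poly_def; apply: eq_bigr => i _; rewrite scale1r.
have Pi (i : 'I_n) : P`_i = 1 by rewrite PE coef_poly ltn_ord.
have szP : size P = n by rewrite PE size_poly_eq ?oner_neq0.
have Pirr : irreducible_poly P := irreducible_geometric_sum n_pr.
(* Applying [g] shifts the sum of the iterates by one place, and its last term returns to [x]. *)
have Pfix : g (horner_alg g P x) = horner_alg g P x.
  rewrite (Dx _ n) ?szP //.
  rewrite (eq_bigr (fun i : 'I_n => iter i g x)); last by move=> i _; rewrite Pi scale1r.
  rewrite linear_sum /= -(prednK n_gt0) big_ord_recr big_ord_recl /= addrC.
  by rewrite -iterS prednK // gnx.
have [Pp|nPp] := boolP (P %| p); last first.
  have cop : coprimep p P by rewrite coprimep_sym irreducible_poly_coprime.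
  have [[u v] /= uv] := Bezout_eq1_coprimepP _ _ cop.
  case/eqP: gx.
  have xE : x = horner_alg g v (horner_alg g P x).
    have : horner_alg g (u * p + v * P) x = x by rewrite uv rmorph1 id_lfunE.
    rewrite mulrC [v * P]mulrC rmorphD !rmorphM add_lfunE !lfun_mulE /= px.
    by rewrite linear0 add0r.
  have gX : horner_alg g 'X = g by rewrite horner_algX.
  have comm y : g (horner_alg g v y) = horner_alg g v (g y).
    have : horner_alg g ('X * v) = horner_alg g (v * 'X) by rewrite mulrC.
    by rewrite !rmorphM /= gX => /(congr1 (fun h : 'End(K) => h y)); rewrite !lfun_mulE.
  by rewrite {1 2}xE comm Pfix.
move=> i j.
have [q pq] : exists q, p = q * P by exists (p %/ P); rewrite divpK.
have [p0|p0] := eqVneq p 0; first by rewrite -!pE p0 !coef0.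
have szq : size q = 1%N.
  have q0 : q != 0 by apply: contraNneq p0 => q0; rewrite pq q0 mul0r.
  have P0 : P != 0 by rewrite -size_poly_gt0 szP.
  have : (size p <= n)%N by apply: size_poly.
  rewrite pq size_mul // szP; move: q0; rewrite -size_poly_gt0.
  by case: (size q) => [|[|k]] // _; rewrite addSn /= addSn /= ltnNge leq_addl.
have /size_poly1P[a _ qa] : size q == 1%N by rewrite szq.
by rewrite -!pE pq qa !coefCM !Pi.
Qed.
End Cyclic.

(** * The roots as a single orbit of prime length *)

Lemma iter_fixed_mul (T : Type) (g : T -> T) (x : T) (a u : nat) :
  iter a g x = x -> iter (u * a) g x = x.
Proof. by move=> gx; elim: u => //= u IHu; rewrite mulSn iterD IHu. Qed.

(** Two equal iterates give a period [j - i] below the prime [n], hence coprime to it; a Bezout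
    relation then makes 1 a period. *)
Lemma iter_prime_inj (T : Type) (g : T -> T) (x : T) (n : nat) :
  injective g -> prime n -> iter n g x = x -> g x <> x ->
  injective (fun i : 'I_n => iter i g x).
Proof.
move=> g_inj n_pr gnx gx i j; wlog ltij : i j / (i < j)%N => [hw|] eqij.
  by have [/hw->|/hw->|/val_inj] := ltngtP i j.
case: gx; have iter_inj m : injective (iter m g).
  by elim: m => [|m IHm] y z //= /g_inj /IHm.
have gax : iter (j - i) g x = x.
  by apply: (iter_inj i); rewrite -iterD subnKC // ltnW.
have a_gt0 : (0 < j - i)%N by rewrite subn_gt0.
have : coprime (j - i) n.
  rewrite coprime_sym prime_coprime // gtnNdvd //.
  by apply: leq_ltn_trans (leq_subr _ _) (ltn_ord j).
case/(coprimeP _ a_gt0) => -[u v] /= uv.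
have uvE : (u * (j - i) = (v * n).+1)%N.
  by rewrite -[RHS]add1n -uv subnK // ltnW // -subn_gt0 uv.
by have := iter_fixed_mul u gax; rewrite uvE iterS iter_fixed_mul.
Qed.

(** By Gauss's lemma [f] is irreducible over Q, so it is the minimal polynomial of [x] up to a
    scalar; the tower law for Q(x) concludes. *)
Lemma degree_dvd_dim (K : fieldExtType rat) (f : {poly int}) (n : nat) (x : K) :
  irreducible_poly f -> size f = n.+1 -> root (map_poly intr f) x ->
  (n %| \dim {:K})%N.
Proof.
move=> /irreducible_rat_int f_irr szf fx.
have fE : map_poly intr f = map_poly (in_alg K) (map_poly intr f).
  by rewrite -map_poly_comp; apply: eq_map_poly => z /=; rewrite scaler_int.
have /polyOver1P[q qE] := minPolyOver 1%AS x.
have qf : q %= map_poly intr f.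
  apply: (apply_irredp f_irr).
    rewrite -(size_map_poly (in_alg K)) -qE.
    by apply: contraTneq (root_minPoly 1%AS x) => /eqP/size_poly1P[c c0 ->]; rewrite rootC.
  rewrite -(dvdp_map (in_alg K)) -qE -fE.
  by apply: minPoly_dvdp => //; rewrite fE alg_polyOver.
have szq : size (minPoly 1%AS x) = n.+1.
  rewrite qE size_map_poly (eqp_size qf) size_map_poly_id0 //.
  by rewrite intr_eq0 lead_coef_eq0 -size_poly_eq0 szf.
have -> : n = adjoin_degree 1%AS x by apply: succn_inj; rewrite -szq size_minPoly.
rewrite adjoin_degreeE dimv1 divn1.
by apply: (@field_dimS _ _ <<1; x>>%AS {:K}%AS); apply: subvf.
Qed.

(** The permutation [p] turns the given numbering of the roots into one on which [g] acts as a
    cyclic shift. *)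
Lemma cyclic_roots (f : {poly int}) (n : nat) (K : splittingFieldType rat)
    (alpha : 'I_n -> K) :
  irreducible_poly f -> size f = n.+1 -> prime n ->
  map_poly intr f = \prod_(i < n) ('X - (alpha i)%:P) ->
  splittingFieldFor 1%AS (map_poly intr f) {:K}%VS ->
  #|'Gal({:K} / 1)%g| = \dim {:K}%VS ->
  exists (g : gal_of {:K}) (x : K) (p : 'S_n),
    [/\ g \in 'Gal({:K} / 1)%g, iter n g x = x, g x != x
      & forall i, alpha (p i) = iter i g x].
Proof.
move=> f_irr szf n_pr f_roots [rs f_rs rs_gen] cardG.
have n_gt0 := prime_gt0 n_pr.
have fE : map_poly intr f = \prod_(z <- codom alpha) ('X - z%:P).
  by rewrite f_roots big_image.
have rootP y : root (map_poly intr f) y -> exists i, y = alpha i.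
  by rewrite fE root_prod_XsubC => /codomP.
have rootA i : root (map_poly intr f) (alpha i).
  by rewrite fE root_prod_XsubC codom_f.
have [g gG g_n] : {g | g \in 'Gal({:K} / 1)%g & #[g]%g = n}.
  apply: Cauchy => //; rewrite cardG.
  exact: degree_dvd_dim f_irr szf (rootA (Ordinal n_gt0)).
have iterE m y : iter m g y = (g ^+ m)%g y.
  elim: m => [|m IHm] /=; first by rewrite gal_id.
  by rewrite expgSr galM ?memvf // IHm.
have gn1 y : iter n g y = y by rewrite iterE -g_n expg_order gal_id.
(* The roots generate [K], so an automorphism fixing all of them is the identity, whose order is not
   prime. *)
have [i0 gi0] : exists i, g (alpha i) != alpha i.
  apply/existsP; rewrite -[X in is_true X]negbK negb_exists.
  apply/negP => /forallP gfix.
  have : g = 1%g.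
    apply/eqP/gal_eqP => y _; rewrite gal_id.
    have : ({:K} <= fixedField [set g])%VS.
      rewrite -{1}rs_gen; apply/Fadjoin_seqP; split; first exact: sub1v.
      move=> z zrs; apply/fixedFieldP; rewrite ?memvf // => _ /set1P->.
      have [i ->] : exists i, z = alpha i.
        by apply: rootP; rewrite (eqp_root f_rs) root_prod_XsubC.
      by apply/eqP; have := gfix i; rewrite negbK.
    by move/subvP => /(_ y (memvf _)) /(fixedFieldP (memvf _)); apply; rewrite set11.
  by move=> g1; move: n_pr; rewrite -g_n g1 order1.
have g_inj : injective g by apply: fmorph_inj.
have groot y : root (map_poly intr f) y -> root (map_poly intr f) (g y).
  move=> fy; have -> : map_poly intr f = map_poly g (map_poly intr f).
    by rewrite -map_poly_comp; apply: eq_map_poly => z /=; rewrite rmorph_int.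
  by rewrite fmorph_root.
have iroot m : root (map_poly intr f) (iter m g (alpha i0)).
  by elim: m => [|m IHm] /=; [apply: rootA | apply: groot].
have [h hE] := choice (fun i : 'I_n => rootP _ (iroot i)).
have h_inj : injective h.
  move=> i j /(congr1 alpha); rewrite -!hE.
  by apply: iter_prime_inj => //; apply/eqP.
exists g, (alpha i0), (perm h_inj); split=> // i.
by rewrite permE hE.
Qed.

(** * Changes of generators of integer spans *)

Lemma zspan_perm (R : realType) (d m : nat) (b : 'I_m -> 'rV[R[i]]_d) (p : 'S_m) :
  zspan (fun i => b (p i)) = zspan b.
Proof.
apply/seteqP; split=> _ [c ->] /=.
  exists (fun i => c (p^-1 i)%g); rewrite [RHS](reindex_inj (@perm_inj _ p)).
  by apply: eq_bigr => i _; rewrite permK.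
by exists (fun i => c (p i)); rewrite [LHS](reindex_inj (@perm_inj _ p)).
Qed.

(** The last generator is minus the sum of the others, so its coefficient is subtracted from
    theirs. *)
Lemma zspan_sum0 (R : realType) (d m : nat) (b : 'I_m.+1 -> 'rV[R[i]]_d) :
  \sum_i b i = 0 -> zspan b = zspan (fun i => b (widen_ord (leqnSn m) i)).
Proof.
rewrite big_ord_recr /= => /eqP; rewrite addrC addr_eq0 => /eqP bE.
apply/seteqP; split=> _ [c ->] /=.
  exists (fun i => c (widen_ord (leqnSn m) i) - c ord_max).
  rewrite big_ord_recr /= bE mulNrz mulrz_suml -sumrB.
  by apply: eq_bigr => i _; rewrite mulrzBr.
exists (fun i => if insub (val i) is Some j then c j else 0).
rewrite big_ord_recr /= insubF ?ltnn // mulr0z addr0.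
by apply: eq_bigr => i _; rewrite /= valK.
Qed.

(** * The norm, discreteness and existence of the minimum *)

Section Norm.
Variables (R : realType) (d : nat).
Implicit Types (x : 'rV[R[i]]_d) (L : set 'rV[R[i]]_d).

Lemma inner_normE x : inner x x = \sum_k `|x 0 k| ^+ 2.
Proof. by apply: eq_bigr => k _; rewrite normCK. Qed.

Lemma inner_enorm x : inner x x = (enorm x ^+ 2)%:C.
Proof.
have x_ge0 : 0 <= inner x x by rewrite inner_normE sumr_ge0 // => k _; rewrite exprn_ge0.
rewrite /enorm sqr_sqrtr ?RRe_real ?ger0_real //.
by have := x_ge0; rewrite lecE => /andP[].
Qed.

Lemma enorm_ge0 x : 0 <= enorm x.
Proof. exact: sqrtr_ge0. Qed.

Lemma normr_le_enorm x k : `|x 0 k| <= (enorm x)%:C.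
Proof.
rewrite -ler_sqr ?nnegrE ?normr_ge0 ?lecR ?enorm_ge0 //.
rewrite [leRHS](_ : _ = inner x x); last by rewrite inner_enorm rmorphXn.
rewrite inner_normE (bigD1 k) //= lerDl sumr_ge0 // => j _.
by rewrite exprn_ge0.
Qed.

Lemma enorm_eq0 x : enorm x = 0 -> x = 0.
Proof.
move=> x0; apply/rowP => k; rewrite mxE; apply/eqP; rewrite -normr_le0.
by have := normr_le_enorm x k; rewrite x0.
Qed.

Lemma enorm0 : enorm (0 : 'rV[R[i]]_d) = 0.
Proof.
by rewrite /enorm /inner big1 ?sqrtr0 // => k _; rewrite mxE mul0r.
Qed.

Lemma finite_int_box (m N : nat) :
  finite_set [set c : 'I_m -> int | forall i, `|c i| <= N%:Z].
Proof.
pose h (f : {ffun 'I_m -> 'I_(N + N).+1}) (i : 'I_m) : int := (f i)%:Z - N%:Z.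
apply: (sub_finite_set (B := range h)); last by apply: finite_image; apply: finite_finset.
move=> c cN /=; exists [ffun i => inord `|(c i + N%:Z)%R|%N] => //.
apply/funext => i; rewrite /h ffunE.
have /andP[c1 c2] : (- N%:Z <= c i <= N%:Z) by rewrite -ler_norml.
have cp : 0 <= c i + N%:Z by rewrite -lerBlDr sub0r.
rewrite inordK; first by rewrite gez0_abs // addrK.
by rewrite ltnS -lez_nat gez0_abs // PoszD lerD2r.
Qed.

(** A right inverse [P] of the matrix recovers the coefficients linearly from the vector, so a bound
    on the norm bounds these integers. *)
Lemma finite_coef_ball (m : nat) (b : 'I_m -> 'rV[R[i]]_d) (r : R) :
  row_free (\matrix_i b i) ->
  finite_set [set c : 'I_m -> int | enorm (\sum_i b i *~ c i) <= r].
Proof.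
move=> /mulmxVp; set M := \matrix_i _; set P := pinvmx M => MP.
(* Summing the moduli of all entries of [P] gives one constant that serves every column. *)
pose C : R[i] := \sum_k \sum_j `|P k j|.
pose N := Num.bound (complex.Re (r%:C * C)).
apply: sub_finite_set (finite_int_box m N) => c /= cr i.
set x := \sum_i b i *~ c i in cr.
have xM : (\row_j (c j)%:~R) *m M = x.
  rewrite mulmx_sum_row; apply: eq_bigr => j _.
  by rewrite mxE rowK scaler_int.
have cE : (c i)%:~R = \sum_k x 0 k * P k i.
  have := congr1 (fun v : 'rV_d => v *m P) xM; rewrite -mulmxA MP mulmx1.
  by move=> /rowP/(_ i); rewrite !mxE.
have cC : `|(c i)%:~R| <= r%:C * C.
  rewrite cE; apply: le_trans (ler_norm_sum _ _ _) _.
  rewrite mulr_sumr; apply: ler_sum => k _; rewrite normrM.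
  apply: ler_pM => //; first by apply: le_trans (normr_le_enorm _ _) _; rewrite lecR.
  by rewrite (bigD1 i) //= lerDl sumr_ge0.
have : (`|c i|%:~R : R) <= complex.Re (r%:C * C).
  by move: cC; rewrite lecE -intr_norm -(rmorph_int (real_complex R)) /= => /andP[].
move=> h; rewrite -(ler_int R); apply: (le_trans h).
rewrite -pmulrn ltW //.
by apply/archi_boundP/(le_trans _ h); rewrite ler0z.
Qed.

Lemma seq_min (T : eqType) (h : T -> R) (s : seq T) (y : T) :
  y \in s -> exists2 x, x \in s & forall z, z \in s -> h x <= h z.
Proof.
elim: s y => // a s IHs y _; case: s IHs => [_|b s IHs].
  by exists a; rewrite ?mem_head // => z; rewrite mem_seq1 => /eqP->.
have [x xs x_min] := IHs b (mem_head _ _).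
have [ax|xa] := leP (h a) (h x).
  exists a; rewrite ?mem_head // => z; rewrite in_cons => /predU1P[->//|/x_min].
  exact: le_trans.
exists x => [|z]; rewrite in_cons ?xs ?orbT // => /predU1P[->|/x_min//].
exact: ltW.
Qed.

(** Only the finitely many nonzero vectors of norm at most [enorm y] compete for the minimum. *)
Lemma is_min_norm_exists L (y : 'rV[R[i]]_d) :
  (forall r, finite_set [set x | L x /\ enorm x <= r]) -> L y -> y != 0 ->
  exists m, is_min_norm L m.
Proof.
move=> /(_ (enorm y))/finite_seqP[s sE] Ly y0.
have sP x : x \in s <-> L x /\ enorm x <= enorm y.
  by have -> : (x \in s) = [set` s] x :> Prop by []; rewrite -sE.
have ys : y \in [seq x <- s | x != 0] by rewrite mem_filter y0; apply/sP.
have [x] := seq_min (@enorm R d) ys.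
rewrite mem_filter => /andP[x0 /sP[Lx xy]] x_min.
exists (enorm x); split; first by exists x.
move=> z Lz z0; have [zy|/ltW yz] := leP (enorm z) (enorm y); last exact: le_trans yz.
by apply: x_min; rewrite mem_filter z0; apply/sP.
Qed.
End Norm.

(** * Counting by orbits *)

(** As [n] is prime and no point of [A] is fixed, every orbit has exactly [n] elements. *)
Lemma card_prime_action (T : choiceType) (A : set T) (g : T -> T) (n : nat) :
  prime n -> finite_set A -> injective g -> (forall x, A x -> A (g x)) ->
  (forall x, A x -> iter n g x = x) -> (forall x, A x -> g x <> x) ->
  exists N : nat, A #= `I_N /\ (n %| N)%N.
Proof.
move=> n_pr /finite_fsetP[X ->] g_inj gX gn gx.
have n_gt0 := prime_gt0 n_pr.
exists #|` X|; split; first exact/card_eq_fsetP.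
pose g' (x : X) : X := [` gX _ (fsvalP x)]%fset.
have val_iter m (x : X) : val (iter m g' x) = iter m g (val x).
  by elim: m => //= m ->.
have g'_inj : injective g' by move=> x y /(congr1 val) /= /g_inj /val_inj.
have g'n x : iter n g' x = x by apply: val_inj; rewrite val_iter gn //; apply: fsvalP.
have g'x x : g' x <> x by move=> /(congr1 val) /=; apply: gx; apply: fsvalP.
rewrite cardfE -(fcard_order_set g'_inj (n := n) (a := predT)) ?dvdn_mull //.
apply/fintype.subsetP => x _; rewrite inE; apply/eqP.
(* The first [n] iterates of [x] form a cycle of [g'] without repetition, so their number is the
   order of [x]. *)
rewrite -(size_traject g' x n); apply: order_cycle (_ : x \in _).
- rewrite -(prednK n_gt0) /= rcons_path fpath_traject last_traject /=.
  by rewrite -iterS prednK // g'n.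
- apply/(uniqP x) => i j; rewrite !inE size_traject => lti ltj.
  rewrite !nth_traject // => eij.
  by have [] := iter_prime_inj g'_inj n_pr (g'n x) (g'x x)
    (eij : iter (Ordinal lti) g' x = iter (Ordinal ltj) g' x).
- by rewrite -(prednK n_gt0) trajectS mem_head.
Qed.

(** * The Minkowski embedding: independence, isometries, norms of integers *)

Section Embedding.
Variables (R : realType) (K : splittingFieldType rat) (iota : {rmorphism K -> R[i]}).
Variables (d : nat) (sigma : d.-tuple (gal_of {:K})).
Hypotheses (d_deg : d = \dim {:K}%VS) (sigma_uniq : uniq sigma).
Hypothesis sigma_gal : sigma =i 'Gal({:K} / 1)%g.

Let mk := minkowski iota sigma.

Lemma minkowski_sum (m : nat) (b : 'I_m -> K) (c : 'I_m -> int) :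
  mk (\sum_i b i *~ c i) = \sum_i mk (b i) *~ c i.
Proof.
apply/rowP => k; rewrite mxE !rmorph_sum summxE; apply: eq_bigr => i _.
by rewrite !rmorphMz -[in RHS]scaler_int !mxE mulrzl.
Qed.

Lemma sigma_card : #|'Gal({:K} / 1)%g| = d.
Proof. by rewrite -(eq_card sigma_gal) (card_uniqP sigma_uniq) size_tuple. Qed.

Lemma tnth_sigma_inj : injective (tnth sigma).
Proof. exact/tuple_uniqP. Qed.

(** The matrix is the image under [iota] of [A *m B]: [A] holds the rational coordinates of the
    [b i] and has full row rank, [B] holds the values of the automorphisms on a basis and is
    invertible by Dedekind's theorem. *)
Lemma minkowski_row_free (m : nat) (b : 'I_m -> K) :
  (forall c : 'I_m -> rat, \sum_i c i *: b i = 0 -> forall i, c i = 0) ->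
  row_free (\matrix_(i < m) mk (b i)).
Proof.
(* Replacing [d] by the dimension makes [B] square. *)
move=> b_free; rewrite /mk; case: _ / (esym d_deg) (sigma) sigma_gal tnth_sigma_inj
  => s s_gal s_inj.
set e := vbasis {:K}.
have eE x : x = \sum_i coord e i x *: e`_i by apply: coord_vbasis; rewrite memvf.
pose B := \matrix_(i < \dim {:K}, k < \dim {:K}) tnth s k e`_i.
have B_unit : B \in unitmx.
  rewrite -unitmx_tr -row_free_unit; apply: inj_row_free => v vB.
  (* Dedekind's theorem is indexed by automorphisms, so [v] is regrouped along [s]; by [s_inj] each
     group is a single entry. *)
  pose c (g : gal_of {:K}) := \sum_(k | tnth s k == g) v 0 k.
  have vs a : \sum_k v 0 k * tnth s k a = 0.
    rewrite (eE a).
    rewrite (eq_bigr (fun k => \sum_i (coord e i a)%:A * (v 0 k * tnth s k e`_i))); last first.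
      move=> k _; rewrite linear_sum mulr_sumr; apply: eq_bigr => i _.
      by rewrite linearZ /= mulr_algl scalerAr.
    rewrite exchange_big big1 // => i _; rewrite -mulr_sumr.
    have /rowP/(_ i) := vB; rewrite !mxE => vBi.
    rewrite [X in _ * X](_ : _ = 0) ?mulr0 // -[RHS]vBi.
    by apply: eq_bigr => k _; rewrite !mxE.
  have c0 : forall g, g \in 'Gal({:K} / 1)%g -> c g = 0.
    apply: gal_independent => a _; rewrite -[RHS](vs a).
    rewrite [RHS](partition_big (tnth s) (mem 'Gal({:K} / 1)%g)) /=; last first.
      by move=> k _; rewrite -s_gal mem_tnth.
    apply: eq_bigr => g _; rewrite mulr_suml; by apply: eq_bigr => k /eqP->.
  apply/rowP => k; rewrite mxE.
  rewrite -[RHS](c0 (tnth s k)) -?s_gal ?mem_tnth // /c (big_pred1 k) // => j.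
  by rewrite /= (inj_eq s_inj).
pose A := \matrix_(i < m, j < \dim {:K}) coord e j (b i).
have A_free : row_free A.
  apply: inj_row_free => v vA; apply/rowP => i; rewrite mxE.
  apply: (b_free (fun i => v 0 i)).
  rewrite (eq_bigr (fun i => \sum_j (v 0 i * A i j) *: e`_j)); last first.
    move=> l _; rewrite {1}(eE (b l)) scaler_sumr; apply: eq_bigr => j _.
    by rewrite scalerA mxE.
  rewrite exchange_big big1 // => j _; rewrite -scaler_suml.
  by have /rowP/(_ j) := vA; rewrite !mxE => ->; rewrite scale0r.
rewrite (_ : \matrix_i _ = map_mx iota (map_mx (in_alg K) A *m B)).
  by rewrite row_free_map /row_free mxrankMfree ?row_free_unit // mxrank_map.
apply/matrixP => i k; rewrite !mxE {1}(eE (b i)) linear_sum; congr (iota _).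
by apply: eq_bigr => j _; rewrite !mxE linearZ /= mulr_algl.
Qed.

Lemma row_free_real_free (m : nat) (b : 'I_m -> 'rV[R[i]]_d) :
  row_free (\matrix_i b i) -> real_free b.
Proof.
move=> b_free c cb i.
have : (\row_i (c i)%:C) *m \matrix_i b i == 0.
  rewrite mulmx_sum_row -[X in _ == X]cb; apply/eqP; apply: eq_bigr => j _.
  by rewrite mxE rowK.
by rewrite mulmx_free_eq0 // => /eqP/rowP/(_ i); rewrite !mxE => -[].
Qed.

Lemma sum_sigma (V : zmodType) (F : gal_of {:K} -> V) :
  \sum_k F (tnth sigma k) = \sum_(s in 'Gal({:K} / 1)%g) F s.
Proof. by rewrite -(big_tuple _ _ _ xpredT) big_uniq // (eq_bigl _ _ sigma_gal). Qed.

(** Passing from [x] to [g x] only permutes the coordinates, by translation by [g] on the Galois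
    group. *)
Lemma enorm_gal (g : gal_of {:K}) (x : K) :
  g \in 'Gal({:K} / 1)%g -> enorm (mk (g x)) = enorm (mk x).
Proof.
move=> gG; suff eq_inner : inner (mk (g x)) (mk (g x)) = inner (mk x) (mk x).
  by rewrite /enorm eq_inner.
pose F (y : K) (s : gal_of {:K}) : R[i] := `|iota (s y)| ^+ 2.
have innerE y : inner (mk y) (mk y) = \sum_(s in 'Gal({:K} / 1)%g) F y s.
  by rewrite -sum_sigma inner_normE; apply: eq_bigr => k _; rewrite mxE.
rewrite !innerE [RHS](reindex_inj (mulgI g)); apply: eq_big => s.
  by rewrite groupMl.
by move=> _; rewrite /F galM ?memvf.
Qed.

Lemma minkowski_inj : injective mk.
Proof.
move=> x y /rowP; have d_gt0 : (0 < d)%N by rewrite -sigma_card cardG_gt0.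
by move/(_ (Ordinal d_gt0)); rewrite !mxE => /fmorph_inj/fmorph_inj.
Qed.

(** All [d] coordinates equal [z]. This applies to the multiples of the trace, itself an integer. *)
Lemma enorm_minkowski_int (z : int) : enorm (mk z%:~R) = Num.sqrt d%:R * `|z%:~R|.
Proof.
apply/eqP; rewrite -(@eqrXn2 _ 2) ?mulr_ge0 ?sqrtr_ge0 ?normr_ge0 //; apply/eqP.
rewrite exprMn [in RHS]sqr_sqrtr ?ler0n //.
apply: complexI; rewrite -inner_enorm inner_normE.
rewrite (eq_bigr (fun=> (`|z%:~R| ^+ 2)%:C)); last first.
  move=> k _; rewrite mxE !rmorph_int rmorphXn /= -!intr_norm.
  by rewrite (rmorph_int (real_complex R)).
by rewrite sumr_const card_ord mulr_natl rmorphMn.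
Qed.
End Embedding.

(** * Action of the automorphism on coefficients *)

(** The automorphism sends the i-th iterate to the next one, so coefficients move up one place and
    the last wraps around to 0. *)
Definition cyclic_shift (m : nat) (c : 'I_m.+1 -> int) (i : 'I_m.+1) : int :=
  if unlift ord0 i is Some j then c (widen_ord (leqnSn m) j) else c ord_max.

Lemma cyclic_shiftE (m : nat) (V : zmodType) (g : {additive V -> V}) (x : V)
    (c : 'I_m.+1 -> int) :
  iter m.+1 g x = x ->
  g (\sum_(i < m.+1) iter i g x *~ c i) = \sum_(i < m.+1) iter i g x *~ cyclic_shift c i.
Proof.
move=> gmx; rewrite raddf_sum big_ord_recr big_ord_recl /= addrC raddfMz -iterS gmx.
rewrite /cyclic_shift unlift_none; congr (_ + _); apply: eq_bigr => i _.
by rewrite liftK raddfMz -iterS.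
Qed.

Lemma cyclic_shift_const (m : nat) (c : 'I_m.+1 -> int) :
  (forall i, cyclic_shift c i = c i) -> forall i, c i = c ord0.
Proof.
move=> cE [k]; elim: k => [|k IHk] ltk; first by congr c; apply: val_inj.
have ltk' : (k < m.+1)%N by apply: ltnW.
rewrite -(IHk ltk') -cE.
rewrite (_ : Ordinal ltk = lift ord0 (Ordinal (ltk : (k < m)%N))) /cyclic_shift ?liftK.
  by congr c; apply: val_inj.
exact: val_inj.
Qed.

(** * Rank and minimal vectors of the lattice *)

Theorem theorem1p2 (R : realType) (f : {poly int}) (n : nat)
  (f_monic : f \is monic) (f_irr : irreducible_poly f)
  (f_deg : size f = n.+1) (n_prime : prime n)
  (K : splittingFieldType rat) (iota : {rmorphism K -> R[i]})
  (alpha : 'I_n -> K)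
  (f_roots : map_poly intr f = \prod_(i < n) ('X - (alpha i)%:P))
  (K_split : splittingFieldFor 1%AS (map_poly intr f) {:K}%VS)
  (d : nat) (d_deg : d = \dim {:K}%VS)
  (sigma : d.-tuple (gal_of {:K}))
  (sigma_uniq : uniq sigma) (sigma_gal : sigma =i 'Gal({:K} / 1)%g) :
  let L := zspan (fun i => minkowski iota sigma (alpha i)) in
  [/\ f`_n.-1 != 0 -> lattice_rank L n,
      f`_n.-1 = 0 -> lattice_rank L n.-1
    & min_norm L < Num.sqrt d%:R * `|(f`_n.-1)%:~R| ->
      exists N : nat, min_vectors L #= `I_N /\ (n %| N)%N].
Proof.
have cardG : #|'Gal({:K} / 1)%g| = \dim {:K}%VS by rewrite (sigma_card sigma_uniq).
have [g [x [p [gG gnx gx alphaE]]]] := cyclic_roots f_irr f_deg n_prime f_roots K_split cardG.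
(* The degree is now [n.+1], so a_(n-1) has index [n] from here on. *)
case: n => [|n] // in f_deg n_prime alpha f_roots p gnx alphaE *.
move=> L; set mk := minkowski iota sigma in L *.
pose beta (i : 'I_n.+1) := iter i g x.
have {}alphaE i : alpha (p i) = beta i by [].
have LE : L = zspan (mk \o beta).
  rewrite /L -(zspan_perm _ p); congr zspan; apply/funext => i /=.
  by rewrite alphaE.
have intK_eq0 z : ((z%:~R : K) == 0) = (z == 0).
  by rewrite -(fmorph_eq0 iota) rmorph_int intr_eq0.
pose t := \sum_i beta i.
have tE : t = (- f`_n)%:~R.
  have fE : map_poly intr f = \prod_(z <- codom alpha) ('X - z%:P) :> {poly K}.
    by rewrite f_roots big_image.
  have := coefPn_prod_XsubC (ps := codom alpha).
  rewrite size_codom card_ord -fE coef_map /= => /(_ isT) fn.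
  rewrite mulrNz fn opprK big_image /= (reindex_inj (@perm_inj _ p)).
  by apply: eq_bigr => i _; rewrite alphaE.
have beta_rel (c : 'I_n.+1 -> rat) : \sum_i c i *: beta i = 0 -> forall i j, c i = c j.
  exact: (@cyclic_relation_const _ _ (gal_repr g)).
have mkE (m : nat) (b : 'I_m -> K) c : mk (\sum_i b i *~ c i) = \sum_i mk (b i) *~ c i.
  exact: minkowski_sum.
have free_rows m (b : 'I_m -> K) :=
  @minkowski_row_free R K iota d sigma d_deg sigma_uniq sigma_gal m b.
(* With all coefficients equal, a relation reads [c i *: t = 0], and the trace [t] is nonzero. *)
have beta_free : f`_n != 0 -> row_free (\matrix_i mk (beta i)).
  move=> fn0; apply: free_rows => c c0 i.
  have c_const := beta_rel c c0.
  move: c0; rewrite (eq_bigr (fun j => c i *: beta j)); last by move=> j _; rewrite (c_const j i).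
  rewrite -scaler_sumr -/t tE => /eqP; rewrite scaler_eq0 => /orP[/eqP//|].
  by rewrite intK_eq0 oppr_eq0 (negPf fn0).
split=> /=.
- move=> fn0; exists (mk \o beta); split=> //.
  exact/row_free_real_free/beta_free.
- move=> fn0; pose w i := widen_ord (leqnSn n) i.
  exists (fun i => mk (beta (w i))); split; last first.
    rewrite LE zspan_sum0 // -[LHS](eq_bigr _ (fun i _ => mulr1z _)) -mkE.
    rewrite (eq_bigr beta); last by move=> i _; rewrite mulr1z.
    by rewrite -/t tE fn0; apply/rowP => k; rewrite !mxE oppr0 !rmorph0.
  apply/row_free_real_free/free_rows => c c0 i.
  (* A relation among the first [n] roots is extended by 0 at the last one; equality of all
     coefficients then makes them vanish. *)
  pose c' (i : 'I_n.+1) : rat := if insub (val i) is Some j then c j else 0.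
  have c'w j : c' (w j) = c j by rewrite /c' /= valK.
  have c'm : c' ord_max = 0 by rewrite /c' insubF //= ltnn.
  rewrite -c'w -c'm; apply: beta_rel.
  rewrite big_ord_recr /= c'm scale0r addr0 -[RHS]c0.
  by apply: eq_bigr => j _; rewrite c'w.
move=> norm_lt.
(* The count takes place in [K], where [g] acts, and is carried to [L] by the injective map [mk]. *)
pose M := [set y | exists c : 'I_n.+1 -> int, y = \sum_i beta i *~ c i].
have LM : L = mk @` M.
  rewrite LE; apply/seteqP; split=> [_ [c ->]|_ [_ [c ->] <-]] /=.
    by exists (\sum_i beta i *~ c i); [exists c | rewrite mkE].
  by exists c; rewrite mkE.
(* If a_(n-1) were 0 the bound would be 0, while [min_norm L] is nonnegative even at its default
   value. *)
have fn0 : f`_n != 0.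
  apply: contraTneq norm_lt => ->; rewrite normr0 mulr0 -leNgt /min_norm.
  by case: xgetP => // m -> [[y [_ _ <-]] _]; apply: enorm_ge0.
have bfree := beta_free fn0.
have finM r : finite_set [set y | M y /\ enorm (mk y) <= r].
  apply: sub_finite_set (finite_image (fun c => \sum_i beta i *~ c i) (finite_coef_ball r bfree)).
  by move=> _ [[c ->] cr] /=; exists c; rewrite //= -mkE.
have mk_inj := @minkowski_inj R K iota d sigma sigma_uniq sigma_gal.
have mk0 : mk 0 = 0 by apply/rowP => k; rewrite !mxE !rmorph0.
have [m m_min] : exists m, is_min_norm L m.
  apply: (@is_min_norm_exists _ _ _ (mk t)).
  - move=> r; apply: sub_finite_set (finite_image mk (finM r)).
    by rewrite LM => _ [[y My <-] yr] /=; exists y.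
  - by rewrite LM; exists t => //; exists (fun=> 1); apply: eq_bigr => i _; rewrite mulr1z.
  - by rewrite -mk0 (inj_eq mk_inj) tE intK_eq0 oppr_eq0.
rewrite (min_norm_eq m_min) in norm_lt.
(* This keeps the zero vector, which [g] fixes, out of [A]. *)
have m0 : m <> 0.
  by have [[y [_ /eqP y0 <-]] _] := m_min => /enorm_eq0.
pose A := [set y | M y /\ enorm (mk y) = m].
have SA : min_vectors L = mk @` A.
  rewrite /min_vectors (min_norm_eq m_min) LM.
  apply/seteqP; split=> [_ [[y My <-] ym]|_ [y [My ym] <-]] /=; first by exists y.
  by split=> //; exists y.
have finA : finite_set A.
  by apply: sub_finite_set (finM m) => y [My ym] /=; rewrite ym.
have [] := @card_prime_action K A g n.+1 n_prime finA.
- exact: fmorph_inj.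
- move=> y [[c ->] ym]; split; last by rewrite (enorm_gal _ sigma_uniq).
  by exists (cyclic_shift c); apply: cyclic_shiftE.
- move=> _ [[c ->] _].
  have iter_sum (I : finType) k (F : I -> K) c' :
      iter k g (\sum_i F i *~ c' i) = \sum_i (iter k g (F i)) *~ c' i.
    elim: k => //= k ->; rewrite rmorph_sum; apply: eq_bigr => i _.
    by rewrite rmorphMz.
  rewrite iter_sum; apply: eq_bigr => i _.
  by rewrite /beta -iterD addnC iterD gnx.
(* By independence, the coefficients of a fixed vector are invariant under the shift, hence
   constant: the vector is [c ord0] times [t]. *)
- move=> _ [[c ->] ym]; rewrite [LHS](cyclic_shiftE c gnx) => /eqP.
  rewrite -subr_eq0 -sumrB => /eqP shift0.
  have c_const : forall i, c i = c ord0.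
    apply: cyclic_shift_const => i; apply/eqP; rewrite -subr_eq0; apply/eqP.
    have := row_free_real_free bfree (c := fun i => (cyclic_shift c i - c i)%:~R).
    move=> /(_ _ i)/eqP; rewrite intr_eq0 => h; apply/eqP/h.
    rewrite -[RHS]mk0 -[in RHS]shift0.
    under [in RHS]eq_bigr => j _ do rewrite -mulrzBr.
    rewrite mkE; apply: eq_bigr => j _.
    by rewrite (rmorph_int (real_complex R)) scaler_int.
  move: ym; rewrite (eq_bigr (fun i => beta i *~ c ord0)); last by move=> i _; rewrite c_const.
  rewrite -mulrz_suml -/t tE -mulrzA -/mk.
  have [-> | c0] := eqVneq (c ord0) 0.
    by rewrite mulr0 mk0 enorm0 => /esym.
  (* As [c ord0] is a nonzero integer, the norm is at least sqrt d * |a_(n-1)|, against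
     [norm_lt]. *)
  rewrite (enorm_minkowski_int _ sigma) => mE.
  move: norm_lt; rewrite -mE ltNge => /negP; apply.
  apply: ler_wpM2l; first exact: sqrtr_ge0.
  rewrite -!intr_norm ler_int normrM normrN ler_peMr // -gtz0_ge1.
  by rewrite normr_gt0.
move=> N [AN nN]; exists N; split=> //; rewrite SA.
apply: card_eq_trans AN; apply: inj_card_eq => u v _ _; exact: mk_inj.
Qed.
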